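(* Let $d\ge 1$ and let $r$ be a prime number. Then every BMZ-collection $\mathcal{C}=(C_1,\ldots,C_{d+2})$ in $\mathbb{R}^d$ (for these $d$ and $r$) admits a Tverberg rainbow $r$-partition, i.e., there exist pairwise disjoint sets $R_1,\ldots,R_r\subseteq C_1\cup\cdots\cup C_{d+2}$ such that $|R_i\cap C_j|\le 1$ for all $i\in[r]$ and $j\in[d+2]$, and $\bigcap_{i=1}^r\operatorname{conv}(R_i)\neq\emptyset$.
   Context: A BMZ-collection (for given $d,r$) is a $(d+2)$-tuple $\mathcal{C}=(C_1,\ldots,C_{d+2})$ of pairwise disjoint finite subsets of $\mathbb{R}^d$ with $|C_1|=\cdots=|C_{d+1}|=r-1$ and $|C_{d+2}|=1$. $[k]=\{1,\ldots,k\}$. The sets $R_i$ are not required to cover the ground set. *)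

(* Defs.v *)
From Stdlib Require Import Reals List ZArith Znumtheory.
Open Scope R_scope.

Definition is_point (d : nat) (x : list R) : Prop := length x = d.

Definition lin_comb (w : list R) (S : list (list R)) (k : nat) : R :=
  fold_right Rplus 0 (map (fun ws => fst ws * nth k (snd ws) 0) (combine w S)).

(* p lies in the convex hull of the finite point set S (conv of empty = empty). *)
Definition in_conv (p : list R) (S : list (list R)) : Prop :=
  exists w : list R,
    length w = length S /\
    Forall (fun a => 0 <= a) w /\
    fold_right Rplus 0 w = 1 /\
    forall k, (k < length p)%nat -> nth k p 0 = lin_comb w S k.

Definition BMZ_collection (d r : nat) (C : nat -> list (list R)) : Prop :=
  (forall j, (j < d + 2)%nat -> NoDup (C j) /\ forall x, In x (C j) -> is_point d x) /\
  (forall j, (j < d + 1)%nat -> length (C j) = (r - 1)%nat) /\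
  length (C (d + 1)%nat) = 1%nat /\
  (forall j k x, (j < d + 2)%nat -> (k < d + 2)%nat -> j <> k ->
     In x (C j) -> ~ In x (C k)).

Definition tverberg_rainbow_partition (d r : nat) (C : nat -> list (list R)) : Prop :=
  exists Rs : nat -> list (list R),
    (forall i, (i < r)%nat -> NoDup (Rs i)) /\
    (forall i i' x, (i < r)%nat -> (i' < r)%nat -> i <> i' ->
       In x (Rs i) -> ~ In x (Rs i')) /\
    (forall i x, (i < r)%nat -> In x (Rs i) ->
       exists j, (j < d + 2)%nat /\ In x (C j)) /\
    (forall i j x y, (i < r)%nat -> (j < d + 2)%nat ->
       In x (Rs i) -> In y (Rs i) -> In x (C j) -> In y (C j) -> x = y) /\
    (exists p, is_point d p /\ forall i, (i < r)%nat -> in_conv p (Rs i)).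

(* Main.v *)
Require Import Defs.
From Stdlib Require Import Reals List ZArith Znumtheory.
From mathcomp Require all_boot all_order all_fingroup all_algebra.
From mathcomp Require zify ring lra boolp Rstruct.
Open Scope R_scope.

(** After Blagojević–Matschke–Ziegler and Matoušek–Tancer–Wagner. Write
    [m = d + 1], [n = r - 1], and let [spoke a] ([a : 'I_r]) be the vertices of a
    simplex in R^n summing to 0. By Sarkaria's tensor trick, placing a point [x] in
    class [a] gives the vector [(x, 1) (x) spoke a] of R^(m n), and a rainbow
    partition with intersecting hulls amounts to a placement for which 0 is a
    nontrivial nonnegative combination of these vectors.

    The placements of the first [d + 1] colors are the facets of an oriented
    pseudomanifold: a ridge obtained by forgetting one point lies in exactly two
    facets, of opposite orientations. Hence the number of facets whose cone contains
    a generic vector [w], counted with signs, behaves like a degree. When one vertex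
    orbit is moved, it changes by the signed number of simplices swept across the
    origin; the cyclic group of order [r] permutes these freely and preserves the
    signs, so the degree modulo [r] does not depend on the points. For the points
    in which color [j] sits at the [j]-th basis vector the degree is
    [((r - 1)!)^(d+1)], which is nonzero modulo the prime [r]. Taking [w] close to
    the opposite of the vector of the last point, some facet cone must contain this
    opposite, which is the desired combination. *)

(* The module confines the MathComp notations, which would change the meaning of
   [theorem2]. *)
Module ColoredTverberg.
Import all_boot all_order all_fingroup all_algebra zify ring lra boolp Rstruct.
Import Order.TTheory GRing.Theory Num.Theory.
Set Implicit Arguments.
Unset Strict Implicit.
Unset Printing Implicit Defensive.
Local Open Scope ring_scope.

(** * Counting the ends of an interval cut out by linear constraints *)

(** Think of [t k] as a lower bound on a parameter when [neg k] and as an upper bound when [pos k].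
    Only the largest lower and the smallest upper bound can satisfy [E], and both do exactly when
    the feasible interval is nonempty. Without upper bounds, the last summand stands for the end at
    infinity. *)
Lemma endpoint_sum (R : realFieldType) (T : finType) (t : T -> R)
    (neg pos : pred T) (i0 : T) :
    neg i0 -> (forall i, neg i -> ~~ pos i) ->
    (forall i k, neg i || pos i -> neg k || pos k -> t i = t k -> i = k) ->
  let E i := [forall k, (k != i) ==>
    ((neg k ==> (t k < t i)) && (pos k ==> (t i < t k)))] in
  (\sum_(i | neg i) (E i : nat) =
    \sum_(i | pos i) (E i : nat) + [forall i, ~~ pos i])%N.
Proof.
move=> neg0 negpos tinj E.
case: (Order.TotalTheory.arg_maxP t neg0) => L negL maxL.
have {}maxL k : neg k -> t k <= t L by exact: maxL.
have -> : (\sum_(i | neg i) (E i : nat) = E L)%N.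
  rewrite (bigD1 L) //= big1 ?addn0 // => i /andP[negi iL].
  apply/eqP; rewrite eqb0; apply/negP => /forallP/(_ L).
  rewrite eq_sym iL negL /= => /andP[lt _].
  by have := maxL _ negi; rewrite leNgt lt.
have EL : E L = [forall k, pos k ==> (t L < t k)].
  apply/forallP/forallP => H k; have := H k.
    case: (k =P L) => [->|/eqP kL] /=; last by case/andP.
    by move=> _; rewrite (negPf (negpos _ negL)).
  move=> Hk; apply/implyP => kL; rewrite Hk andbT; apply/implyP => negk.
  rewrite lt_neqAle maxL // andbT; apply/eqP => /tinj ek.
  by move: kL; rewrite ek ?eqxx // ?negk ?negL.
rewrite EL; case: (pickP pos) => [u0 posu0 | nopos]; last first.
  rewrite big_pred0 // add0n.
  have -> : [forall i, ~~ pos i] by apply/forallP => i; rewrite nopos.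
  by have -> : [forall k, pos k ==> (t L < t k)] by apply/forallP => i; rewrite nopos.
have -> : [forall i, ~~ pos i] = false.
  by apply/negP => /forallP/(_ u0); rewrite posu0.
rewrite addn0.
case: (Order.TotalTheory.arg_minP t posu0) => U posU minU.
have {}minU k : pos k -> t U <= t k by exact: minU.
rewrite (bigD1 U) //= big1 ?addn0; last first.
  move=> i /andP[posi iU].
  apply/eqP; rewrite eqb0; apply/negP => /forallP/(_ U).
  rewrite eq_sym iU posU /= => /andP[_ lt].
  by have := minU _ posi; rewrite leNgt lt.
congr nat_of_bool; apply/forallP/forallP => H k; last first.
  apply/implyP => posk; apply: lt_le_trans (minU _ posk).
  have := H L; rewrite negL /=; case: (L =P U) => [eLU|_ /andP[]//].
  by have := negpos _ negL; rewrite eLU posU.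
apply/implyP => kU; apply/andP; split; apply/implyP => Hk.
  by apply: le_lt_trans (maxL _ Hk) _; have := H U; rewrite posU.
rewrite lt_neqAle minU // andbT; apply/eqP => /tinj ek.
by move: kU; rewrite ek ?eqxx // ?Hk ?posU ?orbT.
Qed.

Lemma big_option_nat (I : finType) (P : pred (option I)) (F : option I -> nat) :
  (\sum_(i | P i) F i = (if P None then F None else 0) +
     \sum_(i | P (Some i)) F (Some i))%N.
Proof.
rewrite big_mkcond (bigD1 None) //=; congr addn.
rewrite (reindex_omap Some id) /=; last by case.
by rewrite [RHS]big_mkcond; apply: eq_bigl => i; rewrite /= eqxx.
Qed.

(* With [s >= 0] a parameter, the indices satisfying [P] are those whose
   constraint [l k - s * b k >= 0] is active at an endpoint of the interval of
   feasible [s]. *)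
Lemma ray_endpoints (R : realFieldType) (I : finType) (l b : I -> R) :
    (forall k, l k != 0) ->
    (forall i k, b i != 0 -> k != i -> l k - l i / b i * b k != 0) ->
    (exists i, 0 < b i) \/ (forall i, b i < 0) ->
  let P i := [&& b i != 0, 0 < l i / b i &
     [forall k, (k != i) ==> (0 < l k - l i / b i * b k)]] in
  ([forall k, (0 < l k)%R] + \sum_(i | (b i < 0)%R) (P i : nat) =
   \sum_(i | (0 < b i)%R) (P i : nat) + [forall i, (b i < 0)%R])%N.
Proof.
move=> l0 lb0 bsgn P.
(* A constraint with [b k = 0] and [l k < 0] never holds, so in its presence all terms vanish. *)
have [/existsP[k0 /andP[/eqP bk0 lk0]]|] := boolP [exists k, (b k == 0) && (l k < 0)].
  have P0 i : P i = false.
    apply/negP => /and3P[bi _ /forallP/(_ k0)]; rewrite bk0 mulr0 subr0.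
    case: eqP => [e|_]; first by rewrite -e bk0 eqxx in bi.
    by rewrite /= ltNge ltW.
  rewrite !big1 ?add0n ?addn0; try by move=> i _; rewrite P0.
  have -> : [forall k, 0 < l k] = false.
    by apply/negP => /forallP/(_ k0); rewrite ltNge ltW.
  by have -> : [forall k, b k < 0] = false
    by apply/negP => /forallP/(_ k0); rewrite bk0 ltxx.
rewrite negb_exists => /forallP stat.
have {}stat k : b k = 0 -> 0 < l k.
  move=> bk; have := stat k; rewrite bk eqxx /= -leNgt le_eqVlt eq_sym.
  by rewrite (negPf (l0 k)).
(* [None] stands for the constraint [s >= 0], a lower bound. Constraint [i] bounds [s] by
   [l i / b i], from below when [b i < 0] and from above when [b i > 0]. *)
pose t o := if o is Some i then l i / b i else 0.
pose neg o := if o is Some i then b i < 0 else true.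
pose pos o := if o is Some i then 0 < b i else false.
have bn0 i : neg (Some i) || pos (Some i) -> b i != 0.
  by rewrite /neg /pos neq_lt.
have disj o : neg o -> ~~ pos o by case: o => //= i; rewrite -leNgt => /ltW.
have tinj o o' : neg o || pos o -> neg o' || pos o' -> t o = t o' -> o = o'.
  case: o o' => [i|] [k|] // Hi Hk /= e.
  - have [->//|ki] := eqVneq k i; have := lb0 i k (bn0 _ Hi) ki.
    by rewrite e divfK ?subrr ?eqxx // bn0.
  - by have := bn0 _ Hi; move/eqP: e; rewrite mulf_eq0 invr_eq0 (negPf (l0 i)) /= => ->.
  - by have := bn0 _ Hk; move/esym/eqP: e; rewrite mulf_eq0 invr_eq0 (negPf (l0 k)) /= => ->.
pose E o := [forall k, (k != o) ==>
  ((neg k ==> (t k < t o)) && (pos k ==> (t o < t k)))].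
have : (\sum_(o | neg o) (E o : nat) =
    \sum_(o | pos o) (E o : nat) + [forall o, ~~ pos o])%N.
  exact: (endpoint_sum (i0 := None)).
rewrite !big_option_nat add0n.
have EN : E None = [forall k, 0 < l k].
  apply/forallP/forallP => H k.
    have := H (Some k); rewrite /=; case: (ltgtP (b k) 0) => [bk|bk|bk _]; last exact: stat.
      by rewrite andbT ltr_ndivrMr // mul0r.
    by rewrite ltr_pdivlMr // mul0r.
  case: k => [k|] //=; case: (ltgtP (b k) 0) => //= bk.
    by rewrite andbT ltr_ndivrMr // mul0r.
  by rewrite ltr_pdivlMr // mul0r.
have ES i : b i != 0 -> E (Some i) = P i.
  move=> bi; rewrite /P bi /=; apply/forallP/andP => [H|[ti /forallP H]].
    split; first by have := H None; rewrite /= andbT.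
    apply/forallP => k; apply/implyP => ki; have := H (Some k).
    have -> /= : Some k != Some i by apply/eqP => -[e]; rewrite e eqxx in ki.
    rewrite subr_gt0; case: (ltgtP (b k) 0) => /= [bk|bk|bk _].
    - by rewrite andbT ltr_ndivrMr.
    - by rewrite ltr_pdivlMr.
    - by rewrite bk mulr0 stat.
  case=> [k|] /=; last by rewrite ti.
  have := H k; have -> : (Some k != Some i) = (k != i) by [].
  case: eqP => //= _; rewrite subr_gt0; case: (ltgtP (b k) 0) => //= bk.
    by rewrite andbT ltr_ndivrMr.
  by rewrite ltr_pdivlMr.
have -> : (\sum_(i | neg (Some i)) (E (Some i) : nat) =
    \sum_(i | (b i < 0)%R) (P i : nat))%N.
  by apply: eq_bigr => i bi; rewrite ES // lt_eqF.
have -> : (\sum_(i | pos (Some i)) (E (Some i) : nat) =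
    \sum_(i | (0 < b i)%R) (P i : nat))%N.
  by apply: eq_bigr => i bi; rewrite ES // gt_eqF.
rewrite /= EN.
(* By [bsgn], having no upper bound amounts to all [b i] being negative. *)
move=> ->; congr (_ + nat_of_bool _)%N.
case: bsgn => [[i bi]|ball]; last first.
  have -> : [forall i, b i < 0] by apply/forallP.
  by apply/forallP => -[k|] //=; rewrite -leNgt ltW.
have -> : [forall i, b i < 0] = false.
  by apply/negP => /forallP/(_ i); rewrite ltNge ltW.
by apply/negP => /forallP/(_ (Some i)); rewrite /= bi.
Qed.

(** * Signed indices of simplicial cones and their boundary formula *)

Section ConeIndex.
Variables (R : realFieldType) (N : nat).
Implicit Types (A B : 'M[R]_N) (w x y b : 'rV[R]_N).

Definition set_row A (i : 'I_N) y : 'M[R]_N :=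
  \matrix_(k, l) (if k == i then y 0 l else A k l).

Lemma row_set_row A i y k :
  row k (set_row A i y) = if k == i then y else row k A.
Proof. by apply/rowP => l; rewrite !mxE; case: eqP => _; rewrite ?mxE. Qed.

Lemma set_row_id A i : set_row A i (row i A) = A.
Proof. by apply/matrixP => k l; rewrite !mxE; case: eqP => // ->. Qed.

Lemma set_row_twice A i y y' : set_row (set_row A i y) i y' = set_row A i y'.
Proof. by apply/matrixP => k l; rewrite !mxE; case: eqP. Qed.

Lemma mul_set_row x A i y :
  x *m set_row A i y = x *m A + x 0 i *: (y - row i A).
Proof.
have -> : set_row A i y = A + delta_mx i 0 *m (y - row i A).
  apply/matrixP => k l; rewrite !mxE big_ord1 !mxE eqxx andbT.
  by case: eqP => [->|_]; rewrite ?mul1r ?mul0r ?addr0 // addrC subrK.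
rewrite mulmxDr mulmxA; congr (_ + _).
rewrite -[_ *: _]mul_scalar_mx; congr (_ *m _).
apply/matrixP => k l; rewrite !ord1 !mxE (bigD1 i) //= big1 ?addr0.
  by rewrite !mxE !eqxx mulr1.
by move=> l' /negPf h; rewrite !mxE h mulr0.
Qed.

Lemma det_set_row A i y : \det (set_row A i y) = (y *m \adj A) 0 i.
Proof.
rewrite (expand_det_row _ i) mxE; apply: eq_bigr => l _.
rewrite !mxE eqxx; congr (_ * _); rewrite /cofactor; congr (_ * \det _).
by apply/matrixP => k k'; rewrite !mxE eq_sym (negPf (neq_lift _ _)).
Qed.

Lemma det_set_row_comb A i b : \det (set_row A i (b *m A)) = b 0 i * \det A.
Proof. by rewrite det_set_row -mulmxA mul_mx_adj mul_mx_scalar mxE mulrC. Qed.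

Lemma mulmx_coord A w u : A \in unitmx -> u *m A = w -> w *m invmx A = u.
Proof. by move=> uA <-; rewrite mulmxK. Qed.

(** With [y = b *m A], one has [w = (l - t *: b) *m A + t *: y], and [t] is chosen so that the old
    row [i] gets coefficient 0. *)
Lemma coord_set_row A i b w (l := w *m invmx A) (t := l 0 i / b 0 i) :
    A \in unitmx -> b 0 i != 0 ->
  w *m invmx (set_row A i (b *m A)) = l - t *: b + t *: delta_mx 0 i.
Proof.
move=> uA bi; apply: mulmx_coord.
  by rewrite unitmxE det_set_row_comb unitrM unitfE bi -unitmxE.
have -> : forall l' t', (l' - t' *: b + t' *: delta_mx 0 i) *m
    set_row A i (b *m A) = l' *m A + (l' 0 i - t' * b 0 i) *: (b *m A - row i A).
  move=> l' t'; rewrite mul_set_row mulmxDl mulmxBl -!scalemxAl -rowE.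
  rewrite !mxE !eqxx mulr1 scalerDl -!addrA; congr (_ + _).
  rewrite [t' *: (_ - _)]scalerBr [t' *: row i A + _]addrCA.
  by rewrite [t' *: row i A + _]addrC subrK addrCA addNr addr0.
by rewrite mulmxKV // /t divfK // subrr scale0r addr0.
Qed.

Definition cone_index w A : int :=
  if (A \in unitmx) && [forall i, 0 < (w *m invmx A) 0 i]
  then sgz (\det A) else 0.

Definition antipodal_index y A : int :=
  if (A \in unitmx) && [forall i, (y *m invmx A) 0 i < 0]
  then sgz (\det A) else 0.

(** Genericity: [w] avoids the linear span of each face opposite to a row, not only the face
    itself. *)
Definition off_faces w A := forall i, ~~ (w <= set_row A i 0)%MS.

Definition positively_independent A :=
  forall c : 'rV[R]_N, (forall i, 0 <= c 0 i) -> c *m A = 0 -> c = 0.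

Lemma off_faces_coord w A i :
  off_faces w A -> A \in unitmx -> (w *m invmx A) 0 i != 0.
Proof.
move=> /(_ i) off uA; apply: contraNneq off => wi.
rewrite -[w](mulmxKV uA); have := mul_set_row (w *m invmx A) A i 0.
by rewrite wi scale0r addr0 => <-; exact: submxMl.
Qed.

(** Follow the ray [w - s *: y] with [y = b *m A], whose coordinates are [l - s *: b]. It crosses
    face [i] at a positive [s] exactly when [w] lies in the cone with row [i] replaced by [y]; the
    sign of [b 0 i] tells an exit from an entry and is also the change of orientation. Starting
    inside plus entries equals exits plus staying inside forever. *)
Lemma cone_index_unit_boundary w A b :
    A \in unitmx -> off_faces w A ->
    (forall i, off_faces w (set_row A i (b *m A))) ->
    (exists i, 0 < b 0 i) \/ (forall i, b 0 i < 0) ->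
  cone_index w A = \sum_i cone_index w (set_row A i (b *m A)) +
    antipodal_index (b *m A) A.
Proof.
move=> uA offA offB bsgn; pose l i := (w *m invmx A) 0 i.
pose P i := [&& b 0 i != 0, 0 < l i / b 0 i &
     [forall k, (k != i) ==> (0 < l k - l i / b 0 i * b 0 k)]].
have uB i : (set_row A i (b *m A) \in unitmx) = (b 0 i != 0).
  by rewrite unitmxE det_set_row_comb unitrM unitfE -unitmxE uA andbT.
have coord i k : b 0 i != 0 -> (w *m invmx (set_row A i (b *m A))) 0 k =
    if k == i then l i / b 0 i else l k - l i / b 0 i * b 0 k.
  have entry u t : (u - t *: b + t *: delta_mx 0 i) 0 k =
      u 0 k - t * b 0 k + t * (k == i)%:R by rewrite !mxE.
  move=> bi; rewrite coord_set_row // entry -/(l k) -/(l i).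
  case: eqP => [->|_]; last by rewrite mulr0 addr0.
  by rewrite divfK // subrr add0r mulr1.
have idxB i : cone_index w (set_row A i (b *m A)) =
    sgz (\det A) * (sgz (b 0 i) * (P i)%:Z).
  rewrite /cone_index uB /P det_set_row_comb sgzM.
  case: eqP => [->|/eqP bi] /=; first by rewrite sgz0 mul0r mulr0.
  set q := [forall k, _]; set q' := _ && _.
  have -> : q = q'.
    apply/forallP/andP => [H|[ti /forallP H] k].
      split; first by have := H i; rewrite coord ?eqxx.
      by apply/forallP => k; apply/implyP => ki; have := H k; rewrite coord // (negPf ki).
    by rewrite coord //; have := H k; case: eqP.
  by case: q'; rewrite ?mulr1 ?mulr0 // mulrC.
have -> : cone_index w A = sgz (\det A) * ([forall k, 0 < l k] : nat)%:Z.
  by rewrite /cone_index uA /=; case: [forall k, _]; rewrite ?mulr1 ?mulr0.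
have -> : antipodal_index (b *m A) A =
    sgz (\det A) * ([forall i, b 0 i < 0] : nat)%:Z.
  rewrite /antipodal_index uA /= mulmxK //.
  by case: [forall k, _]; rewrite ?mulr1 ?mulr0.
rewrite (eq_bigr _ (fun i _ => idxB i)) -mulr_sumr -mulrDr; congr (_ * _).
have key : ([forall k, (0 < l k)%R] + \sum_(i | (b 0 i < 0)%R) (P i : nat) =
   \sum_(i | (0 < b 0 i)%R) (P i : nat) + [forall i, (b 0 i < 0)%R])%N.
  apply: (ray_endpoints (l := l) (b := fun i => b 0 i)) => //.
  - by move=> k; exact: off_faces_coord.
  - move=> i k bi ki; have := off_faces_coord k (offB i).
    by rewrite uB bi coord // (negPf ki); apply.
have -> : \sum_i sgz (b 0 i) * (P i)%:Z =
    (\sum_(i | (0 < b 0 i)%R) (P i : nat))%N%:Z -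
    (\sum_(i | (b 0 i < 0)%R) (P i : nat))%N%:Z.
  rewrite !(big_morph Posz PoszD (erefl _)).
  rewrite [X in _ = X - _]big_mkcond [X in _ = _ - X]big_mkcond -sumrB.
  apply: eq_bigr => i _; case: sgzP => bi; rewrite ?mul0r ?subr0 ?mul1r ?sub0r ?mulN1r //.
lia.
Qed.

Lemma cone_index_xrow w A i k :
  i != k -> cone_index w (xrow i k A) = - cone_index w A.
Proof.
move=> ik; rewrite /cone_index xrowE unitmx_mul unitmx_perm /=.
have [uA|_] /= := boolP (A \in unitmx); last by rewrite oppr0.
have -> : w *m invmx (tperm_mx i k *m A) = xcol i k (w *m invmx A).
  apply: mulmx_coord; first by rewrite unitmx_mul unitmx_perm.
  rewrite xcolE mulmxA -[_ *m _ *m tperm_mx _ _]mulmxA -perm_mxM tperm2.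
  by rewrite perm_mx1 mulmx1 mulmxKV.
have -> : [forall l, 0 < (xcol i k (w *m invmx A)) 0 l] =
    [forall l, 0 < (w *m invmx A) 0 l].
  apply/forallP/forallP => H l.
    by have := H (tperm i k l); rewrite mxE tpermK.
  by rewrite mxE.
rewrite det_mulmx det_perm odd_tperm ik expr1 mulN1r sgzN.
by case: [forall _, _]; rewrite ?oppr0.
Qed.

Lemma off_faces_xrow w A i k : off_faces w A -> off_faces w (xrow i k A).
Proof.
move=> off l; apply: contra (off (tperm i k l)) => /submx_trans; apply.
have -> : set_row (xrow i k A) l 0 = tperm_mx i k *m set_row A (tperm i k l) 0.
  rewrite -xrowE; apply/matrixP => j j'; rewrite !mxE.
  by rewrite (inj_eq perm_inj).
exact: submxMl.
Qed.

(* [antipodal_index y A] does not involve [w]: it records whether the simplex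
   spanned by [y] and the rows of [A] contains the origin. *)
Lemma cone_index_boundary w A y :
    off_faces w A -> (forall i, off_faces w (set_row A i y)) ->
    off_faces y A -> positively_independent A ->
  cone_index w A = \sum_i cone_index w (set_row A i y) + antipodal_index y A.
Proof.
move=> offA offB offy posA; have [uA|nuA] := boolP (A \in unitmx).
  set b := y *m invmx A.
  have def_y : y = b *m A by rewrite mulmxKV.
  have bn0 i : b 0 i != 0 by exact: off_faces_coord.
  rewrite def_y in offB *; apply: cone_index_unit_boundary => //.
  have [/existsP|] := boolP [exists i, 0 < b 0 i]; first by left.
  rewrite negb_exists => /forallP bneg; right=> i.
  by have := bneg i; rewrite -leNgt le_eqVlt (negPf (bn0 i)).
(* For singular [A], use an invertible replacement [A'] if there is one, and apply the invertible
   case to [A'] and the old row [i]. The cones obtained differ by row swaps from those to be summed,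
   so everything cancels. *)
rewrite {1}/cone_index /antipodal_index (negPf nuA) /= addr0.
have [/existsP[i uA']|] := boolP [exists i, set_row A i y \in unitmx]; last first.
  rewrite negb_exists => /forallP nu.
  by rewrite big1 // => i _; rewrite /cone_index (negPf (nu i)).
set A' := set_row A i y in uA' *.
have [b bA'] : exists b, b *m A' = row i A.
  by exists (row i A *m invmx A'); rewrite mulmxKV.
have AE : set_row A' i (b *m A') = A by rewrite bA' set_row_twice set_row_id.
have bi : b 0 i = 0.
  apply/eqP; apply: contraNT nuA => bi.
  by rewrite -AE unitmxE det_set_row_comb unitrM unitfE bi -unitmxE.
have swap k : k != i -> set_row A' k (b *m A') = xrow i k (set_row A k y).
  move=> ki; rewrite bA'; apply/row_matrixP => l.
  rewrite row_set_row row_set_row.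
  have -> : row l (xrow i k (set_row A k y)) = row (tperm i k l) (set_row A k y).
    by apply/rowP => j; rewrite !mxE.
  rewrite row_set_row; case: (tpermP i k l) => [->|->|].
  - by rewrite eq_sym (negPf ki) !eqxx.
  - by rewrite !eqxx eq_sym (negPf ki).
  - by move=> /eqP/negPf -> /eqP/negPf ->.
(* Otherwise [delta_mx 0 i - b] would be a nontrivial nonnegative relation between the rows of
   [A]. *)
have bpos : exists k, 0 < b 0 k.
  apply/existsP; rewrite -[X in is_true X]negbK negb_exists; apply/negP.
  move=> /forallP bneg; have : delta_mx 0 i - b = 0.
    apply: posA => [k|].
      rewrite !mxE; have := bneg k; rewrite -leNgt => bk.
      by rewrite subr_ge0 (le_trans bk) ?ler0n.
    rewrite mulmxBl -rowE; have := mul_set_row b A i y.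
    by rewrite -/A' bi scale0r addr0 => <-; rewrite bA' subrr.
  by move/rowP/(_ i); rewrite !mxE bi !eqxx subr0 => /eqP; rewrite oner_eq0.
have offA' k : off_faces w (set_row A' k (b *m A')).
  have [->|ki] := eqVneq k i; first by rewrite AE.
  by rewrite swap //; exact: off_faces_xrow.
have := cone_index_unit_boundary uA' (offB i) offA' (or_introl bpos).
rewrite /antipodal_index mulmxK //.
have -> : [forall k, b 0 k < 0] = false.
  by apply/negP => /forallP/(_ i); rewrite bi ltxx.
rewrite andbF addr0 (bigD1 i) //= AE {2}/cone_index (negPf nuA) /= add0r => e.
rewrite (bigD1 i) //= -/A' e.
rewrite -big_split /= big1 // => k ki; rewrite swap // cone_index_xrow.
  by rewrite addNr.
by rewrite eq_sym.
Qed.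

Lemma antipodal_index_mulmx w A B :
  B \in unitmx -> antipodal_index (w *m B) (A *m B) = antipodal_index w A * sgz (\det B).
Proof.
move=> uB; rewrite /antipodal_index unitmx_mul uB andbT.
have [uA|_] /= := boolP (A \in unitmx); last by rewrite mul0r.
have -> : w *m B *m invmx (A *m B) = w *m invmx A.
  apply: mulmx_coord; first by rewrite unitmx_mul uA.
  by rewrite mulmxA mulmxKV.
by rewrite det_mulmx sgzM; case: [forall _, _]; rewrite ?mul0r.
Qed.

Lemma mul_set_row0 c A i y :
  c *m set_row A i y = c *m set_row A i 0 + c 0 i *: y.
Proof. by rewrite !mul_set_row sub0r scalerBr scalerN addrAC addrA. Qed.

Lemma set_row0_sub A i : (set_row A i 0 <= A)%MS.
Proof.
apply/row_subP => k; rewrite row_set_row.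
by case: eqP => _; rewrite ?sub0mx ?row_sub.
Qed.

Lemma set_rowC A i k x y :
  k != i -> set_row (set_row A i x) k y = set_row (set_row A k y) i x.
Proof.
move=> ki; apply/matrixP => l j; rewrite !mxE.
by case: (l =P k) => [->|//]; rewrite (negPf ki).
Qed.

Lemma sub_of_scale (c : R) x A : c != 0 -> (c *: x <= A)%MS -> (x <= A)%MS.
Proof. by move=> c0 h; rewrite -[x](scalerK c0) scalemx_sub. Qed.

(** If [w] lay on a face involving [y] with a nonzero coefficient, solving for [y] would put it in
    the span of [w] and the remaining rows. *)
Lemma off_faces_set_row w A i y :
    off_faces w A ->
    (forall k, k != i -> ~~ (y <= set_row (set_row A i 0) k w)%MS) ->
  off_faces w (set_row A i y).
Proof.
move=> offw yk k; have [->|ki] := eqVneq k i.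
  by rewrite set_row_twice.
apply/negP => /submxP[c]; rewrite set_rowC // mul_set_row0.
have [ci|ci] := eqVneq (c 0 i) 0 => wc.
  case/negP: (offw k); rewrite wc ci scale0r addr0 mul_set_row ci scale0r addr0.
  exact: submxMl.
case/negP: (yk k ki); apply: (sub_of_scale ci).
have -> : c 0 i *: y = w - c *m set_row (set_row A k 0) i 0.
  by rewrite wc addrAC subrr add0r.
set D := set_row (set_row A i 0) k w.
apply: addmx_sub; first by have := row_sub k D; rewrite row_set_row eqxx.
rewrite eqmx_opp -set_rowC //; apply: submx_trans (submxMl _ _) _.
by rewrite -(set_row_twice _ k w 0); exact: set_row0_sub.
Qed.

Lemma positively_independent_set_row A i y :
    positively_independent A -> ~~ (y <= set_row A i 0)%MS ->
  positively_independent (set_row A i y).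
Proof.
move=> posA yi c c0 cA; have [ci|ci] := eqVneq (c 0 i) 0.
  by apply: posA => //; move: cA; rewrite mul_set_row ci scale0r addr0.
case/negP: yi; apply: (sub_of_scale ci); have /eqP := cA.
rewrite mul_set_row0 addrC addr_eq0 => /eqP ->.
by rewrite eqmx_opp submxMl.
Qed.

End ConeIndex.

(** * Generic perturbation preserving finitely many strict inequalities *)

Section Perturbation.
Variables (R : realFieldType) (N : nat).
Implicit Types (p q : 'rV[R]_N) (f g : 'cV[R]_N).

Lemma negative_forms_open (s : seq 'cV[R]_N) p q :
    {in s, forall g, (p *m g) 0 0 < 0} ->
  exists2 e : R, 0 < e & {in s, forall g, ((p + e *: q) *m g) 0 0 < 0}.
Proof.
have entry e g : ((p + e *: q) *m g) 0 0 = (p *m g) 0 0 + e * (q *m g) 0 0.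
  by rewrite mulmxDl -scalemxAl mxE [X in _ + X]mxE.
move=> ps; suff [e e0 he] : exists2 e : R, 0 < e &
    forall e', 0 < e' -> e' <= e ->
    {in s, forall g, ((p + e' *: q) *m g) 0 0 < 0}.
  by exists e => //; exact: he.
elim: s ps => [|g s IH] ps; first by exists 1.
have [g'|e1 e10 he1] := IH; first by move=> g's; apply: ps; rewrite inE g's orbT.
have pg : (p *m g) 0 0 < 0 by apply: ps; rewrite inE eqxx.
pose a := (p *m g) 0 0; pose b := `|(q *m g) 0 0| + 1.
have b0 : 0 < b by rewrite ltr_wpDl.
(* The 1 added in [b] keeps the division legitimate and makes the resulting inequality strict. *)
exists (Num.min e1 (- a / b)) => [|e' e'0].
  by rewrite lt_min e10 divr_gt0 // oppr_gt0.
rewrite le_min => /andP[e'e1 e'b] g'; rewrite inE => /predU1P[->|g's].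
  rewrite entry -/a; have : e' * b <= - a by rewrite -ler_pdivlMr.
  have : e' * (q *m g) 0 0 <= e' * `|(q *m g) 0 0|.
    by rewrite ler_pM2l // ler_norm.
  by rewrite /b mulrDr mulr1; lra.
exact: he1.
Qed.

(** A form that vanishes at [p] becomes nonzero after a small move along its own transpose, since a
    nonzero sum of squares is positive. *)
Lemma perturb_off_forms (fs s : seq 'cV[R]_N) p :
    {in fs, forall f, f != 0} -> {in s, forall g, (p *m g) 0 0 < 0} ->
  exists2 p' : 'rV[R]_N, {in s, forall g, (p' *m g) 0 0 < 0} &
    {in fs, forall f, (p' *m f) 0 0 != 0}.
Proof.
elim: fs s p => [|f fs IH] s p fs0 ps; first by exists p.
have {}IH := IH _ _ (fun f' h => fs0 f' (mem_behead (s := f :: fs) h)).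
have [p1 p1s p1f] : exists2 p1 : 'rV[R]_N, {in s, forall g, (p1 *m g) 0 0 < 0} &
    (p1 *m f) 0 0 != 0.
  have [pf|pf] := eqVneq ((p *m f) 0 0) 0; last by exists p.
  have [e e0 he] := negative_forms_open f^T ps.
  exists (p + e *: f^T) => //; rewrite mulmxDl mxE pf add0r -scalemxAl mxE.
  apply: mulf_neq0; first by rewrite gt_eqF.
  rewrite mxE psumr_neq0; last first.
    by move=> i _; rewrite mxE -expr2 sqr_ge0.
  have /matrix0Pn[i [j]] : f != 0 by apply: fs0; rewrite inE eqxx.
  rewrite ord1 => fi; apply/hasP; exists i; first exact: mem_index_enum.
  by rewrite mxE -expr2 lt_neqAle sqr_ge0 andbT eq_sym sqrf_eq0.
(* The sign reached by [f] is recorded as one more strict inequality, which the later perturbations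
   preserve. *)
have [f' f'E f'lt] : exists2 f', f' = f \/ f' = - f & (p1 *m f') 0 0 < 0.
  case: (ltgtP ((p1 *m f) 0 0) 0) p1f => // h _; first by exists f; [left|].
  by exists (- f); [right|rewrite mulmxN mxE oppr_lt0].
have [g|p2 p2s p2f] := IH (f' :: s) p1.
  by rewrite inE => /predU1P[->//|]; apply: p1s.
exists p2 => [g gs|g]; first by apply: p2s; rewrite inE gs orbT.
rewrite inE => /predU1P[->|]; last exact: p2f.
have := p2s f' (mem_head _ _); case: f'E => ->; first by move/lt_eqF ->.
by rewrite mulmxN mxE oppr_lt0 => /gt_eqF ->.
Qed.

(** The row space of a singular matrix lies in the kernel of a nonzero form, here a nonzero column
    of its cokernel matrix. *)
Lemma perturb_off_subspaces (Bs : seq 'M[R]_N) (s : seq 'cV[R]_N) p :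
    {in Bs, forall B, B \notin unitmx} -> {in s, forall g, (p *m g) 0 0 < 0} ->
  exists2 p' : 'rV[R]_N, {in s, forall g, (p' *m g) 0 0 < 0} &
    {in Bs, forall B, ~~ (p' <= B)%MS}.
Proof.
have form (B : 'M[R]_N) : B \notin unitmx -> exists2 f : 'cV[R]_N, f != 0 & B *m f = 0.
  rewrite -row_full_unit -cokermx_eq0 => h.
  have /matrix0Pn[i [j Cij]] := h.
  exists (col j (cokermx B)); last by rewrite colE mulmxA mulmx_coker mul0mx.
  by apply: contraNneq Cij => /colP/(_ i); rewrite !mxE => ->.
move=> nuBs ps.
have [fs fs0 fsB] : exists2 fs : seq 'cV[R]_N, {in fs, forall f, f != 0} &
    {in Bs, forall B, exists2 f, f \in fs & B *m f = 0}.
  elim: Bs nuBs => [|B Bs IH] nuBs; first by exists [::].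
  have [|fs fs0 fsB] := IH; first by move=> B' h; apply: nuBs; rewrite inE h orbT.
  have [|f f0 Bf] := form B; first by apply: nuBs; rewrite mem_head.
  exists (f :: fs) => f'; rewrite inE => /predU1P[->//|]; first exact: fs0.
    by exists f; rewrite ?mem_head.
  by move=> /fsB[g gfs Bg]; exists g => //; rewrite inE gfs orbT.
have [p' p's p'f] := perturb_off_forms fs0 ps; exists p' => // B /fsB[f ffs Bf].
apply: contra (p'f f ffs) => /submxP[c ->].
by rewrite -mulmxA Bf mulmx0 mxE.
Qed.

Lemma set_row0_singular (A : 'M[R]_N) i : set_row A i 0 \notin unitmx.
Proof. by rewrite unitmxE det_set_row mul0mx mxE unitr0. Qed.

End Perturbation.

(** * The labelled facets, their orientations and their degree *)

Section Degree.
Variables (R : realFieldType) (m n : nat).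
Let N := (m * n)%N.

Definition spoke (a : 'I_n.+1) : 'rV[R]_n :=
  if unlift ord_max a is Some k then delta_mx 0 k else const_mx (-1).

Lemma spoke_lift k : spoke (lift ord_max k) = delta_mx 0 k.
Proof. by rewrite /spoke liftK. Qed.

Lemma spoke_max : spoke ord_max = const_mx (-1).
Proof. by rewrite /spoke unlift_none. Qed.

Lemma spoke_sum : \sum_a spoke a = 0.
Proof.
rewrite (bigD1_ord ord_max) //= spoke_max; apply/rowP => l.
rewrite !mxE summxE (bigD1 l) //= big1 ?addr0.
  by rewrite spoke_lift mxE !eqxx addNr.
by move=> k kl; rewrite spoke_lift mxE eq_sym (negPf kl).
Qed.

Definition spoke_perm_mx (p : 'S_n.+1) : 'M[R]_n :=
  \matrix_k spoke (p (lift ord_max k)).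

(** The matrix is prescribed on the basis spokes only; the last spoke follows because the relation
    [spoke_sum] is invariant under permutations. *)
Lemma mul_spoke_perm a p : spoke a *m spoke_perm_mx p = spoke (p a).
Proof.
case: (unliftP ord_max a) => [k ->|->]; first by rewrite spoke_lift -rowE rowK.
rewrite spoke_max; have := spoke_sum.
rewrite (reindex_inj (@perm_inj _ p)) (bigD1_ord ord_max) //= => /eqP.
rewrite addr_eq0 => /eqP ->; apply/rowP => l; rewrite !mxE summxE -sumrN.
by apply: eq_bigr => k _; rewrite !mxE mulN1r.
Qed.

Definition perm_act (p : 'S_n.+1) : 'M[R]_N := lin_mulmxr (spoke_perm_mx p).

Lemma mul_perm_act (M : 'M[R]_(m, n)) p :
  mxvec M *m perm_act p = mxvec (M *m spoke_perm_mx p).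
Proof. by rewrite /perm_act mul_vec_lin. Qed.

Lemma perm_actM p q : perm_act p *m perm_act q = perm_act (p * q)%g.
Proof.
apply/row_matrixP => i; rewrite row_mul !rowE -[delta_mx 0 i]vec_mxK.
rewrite !mul_perm_act -mulmxA; congr (mxvec (_ *m _)).
by apply/row_matrixP => k; rewrite row_mul !rowK mul_spoke_perm permM.
Qed.

Lemma perm_act1 : perm_act 1 = 1%:M.
Proof.
apply/row_matrixP => i; rewrite !rowE mulmx1 -[delta_mx 0 i]vec_mxK.
rewrite !mul_perm_act -[in RHS](mulmx1 (vec_mx _)); congr (mxvec (_ *m _)).
by apply/row_matrixP => k; rewrite rowK perm1 spoke_lift row1.
Qed.

Lemma perm_act_unit p : perm_act p \in unitmx.
Proof.
have : perm_act p *m perm_act p^-1 = 1%:M by rewrite perm_actM mulgV perm_act1.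
by case/mulmx1_unit.
Qed.

Definition shift (a : 'I_n.+1) : 'S_n.+1 := perm (@addIr _ a).

Lemma shiftD a b : (shift a * shift b)%g = shift (a + b).
Proof. by apply/permP => x; rewrite permM !permE addrA. Qed.

(** Inverse of [mxvec_index]: a row index is read as a color together with the rank of a point in
    that color. *)
Definition vertex (i : 'I_N) : 'I_m * 'I_n :=
  enum_val (cast_ord (esym (mxvec_cast m n)) i).

Lemma vertexK j k : vertex (mxvec_index j k) = (j, k).
Proof. by rewrite /vertex cast_ordK enum_rankK. Qed.

Lemma vertex_inj : injective vertex.
Proof. by move=> i i' /enum_val_inj/cast_ord_inj. Qed.

Definition facet := {ffun 'I_m -> 'S_n.+1}.
Implicit Type s : facet.

(* A permutation of ['I_n.+1] encodes a placement of [n] points into [n.+1]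
   distinct classes: [ord_max] is sent to the class that stays empty. *)
Definition label s (i : 'I_N) : 'I_n.+1 :=
  s (vertex i).1 (lift ord_max (vertex i).2).

(** Row [i] of [X] is thought of as a point in class 0, which the shift moves to its label. Allowing
    arbitrary rows leaves room for generic choices while keeping the cyclic symmetry. *)
Definition facet_mx s (X : 'M[R]_N) : 'M[R]_N :=
  \matrix_i (row i X *m perm_act (shift (label s i))).

Definition orient s : int := \prod_j (-1) ^+ (s j).

Definition degree w (X : 'M[R]_N) : int :=
  \sum_s orient s * cone_index w (facet_mx s X).

Lemma facet_mx_set_row s X i y : facet_mx s (set_row X i y) =
  set_row (facet_mx s X) i (y *m perm_act (shift (label s i))).
Proof.
apply/row_matrixP => k; rewrite rowK !row_set_row rowK.
by case: eqP => // ->.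
Qed.

Definition mul_at s j (p : 'S_n.+1) : facet :=
  [ffun j' => if j' == j then (p * s j')%g else s j'].

(** Point [i] moves to the class its color left empty, and its former class becomes the empty
    one. *)
Definition flip i s : facet :=
  mul_at s (vertex i).1 (tperm ord_max (lift ord_max (vertex i).2)).

Lemma flipK i : involutive (flip i).
Proof.
move=> s; apply/ffunP => j; rewrite !ffunE; case: eqP => // _.
by rewrite mulgA tperm2 mul1g.
Qed.

Lemma label_flip i k s : k != i -> label (flip i s) k = label s k.
Proof.
move=> ki; rewrite /label ffunE; case: eqP => // ej.
rewrite permM tpermD //; first exact: neq_lift.
apply: contra ki => /eqP/lift_inj ek; apply/eqP/vertex_inj.
by apply/eqP; rewrite -pair_eqE /= ej ek !eqxx.
Qed.

Lemma orient_mul_at s j p : orient (mul_at s j p) = (-1) ^+ p * orient s.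
Proof.
rewrite /orient (bigD1 j) //= [X in _ = _ * X](bigD1 j) //= mulrA.
rewrite ffunE eqxx odd_permM signr_addb; congr (_ * _).
by apply: eq_bigr => j' h; rewrite ffunE (negPf h).
Qed.

Lemma orient_flip i s : orient (flip i s) = - orient s.
Proof. by rewrite orient_mul_at odd_tperm neq_lift mulN1r. Qed.

Lemma orient1 : orient [ffun=> 1%g] = 1.
Proof. by rewrite /orient big1 // => j _; rewrite ffunE odd_perm1. Qed.

Lemma orient_sqr s : orient s * orient s = 1.
Proof.
by rewrite /orient -big_split big1 // => j _; rewrite /= -signr_addb addbb.
Qed.

Lemma sgz_orient s : sgz ((orient s)%:~R : R) = orient s.
Proof.
have /eqP := orient_sqr s; rewrite -expr2 sqrf_eq1 => /orP[] /eqP ->.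
  exact: sgz1.
by rewrite rmorphN sgzN sgz1.
Qed.

(* The ridge opposite to vertex [i] lies in exactly the facets [s] and
   [flip i s], which have opposite orientations. *)
Lemma ridge_cancel w X y i i0 : i != i0 ->
  \sum_s orient s * cone_index w
    (set_row (facet_mx s X) i (y *m perm_act (shift (label s i0)))) = 0.
Proof.
move=> ii0; set S := \sum_s _.
suff : S = - S by lia.
rewrite {1}/S (reindex_inj (inv_inj (flipK i))) /= -sumrN.
apply: eq_bigr => s _; rewrite orient_flip mulNr.
have -> : label (flip i s) i0 = label s i0 by apply: label_flip; rewrite eq_sym.
congr (- (_ * cone_index _ _)); apply/row_matrixP => k; rewrite 2!row_set_row.
by have [//|ki] := eqVneq k i; rewrite !rowK label_flip.
Qed.

Definition rotate a s : facet := [ffun j => (s j * shift a)%g].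

Lemma label_rotate a s i : label (rotate a s) i = label s i + a.
Proof. by rewrite /label ffunE permM [LHS]permE. Qed.

Lemma facet_mx_rotate a s X :
  facet_mx (rotate a s) X = facet_mx s X *m perm_act (shift a).
Proof.
apply/row_matrixP => i; rewrite row_mul !rowK label_rotate -shiftD.
by rewrite -perm_actM mulmxA.
Qed.

Lemma orient_rotate a s :
  orient (rotate a s) = orient s * orient (rotate a [ffun=> 1%g]).
Proof.
rewrite /orient -big_split; apply: eq_bigr => j _ /=.
by rewrite !ffunE mul1g odd_permM signr_addb.
Qed.

Definition base : 'M[R]_N :=
  \matrix_i mxvec (delta_mx (vertex i).1 0 *m spoke 0).

Lemma row_facet_base s i :
  row i (facet_mx s base) = mxvec (delta_mx (vertex i).1 0 *m spoke (label s i)).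
Proof.
by rewrite !rowK mul_perm_act -mulmxA mul_spoke_perm permE add0r.
Qed.

Lemma facet_base1 : facet_mx [ffun=> 1%g] base = 1%:M.
Proof.
apply/row_matrixP => i; rewrite row_facet_base row1.
case/mxvec_indexP: i => j k; rewrite /label vertexK /= ffunE perm1 spoke_lift.
by rewrite mul_delta_mx mxvec_delta.
Qed.

Lemma sum_vertex (V : nmodType) (F : 'I_m -> 'I_n -> V) :
  \sum_i F (vertex i).1 (vertex i).2 = \sum_j \sum_k F j k.
Proof.
rewrite pair_big /= (reindex (fun jk : 'I_m * 'I_n => mxvec_index jk.1 jk.2)) /=.
  by apply: eq_bigr => -[j k] _; rewrite vertexK.
exists vertex => [[j k] _|i _]; first by rewrite vertexK.
by apply: vertex_inj; case: (vertex i) => j k; rewrite vertexK.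
Qed.

(** The new row carries the spoke missing from its color, which is minus the sum of the other
    spokes. Its coefficient on the replaced row is therefore -1. *)
Lemma det_facet_base_flip i s :
  \det (facet_mx (flip i s) base) = - \det (facet_mx s base).
Proof.
pose j := (vertex i).1.
pose b : 'rV[R]_N := \row_k (- ((vertex k).1 == j)%:R).
have -> : facet_mx (flip i s) base =
    set_row (facet_mx s base) i (b *m facet_mx s base).
  apply/row_matrixP => k; rewrite row_set_row !row_facet_base.
  case: eqP => [->|/eqP ki]; last by rewrite label_flip // row_facet_base.
  rewrite mulmx_sum_row.
  under eq_bigr => l _ do rewrite row_facet_base mxE /label.
  rewrite (sum_vertex (fun j' k' => - (j' == j)%:R *:
     mxvec (delta_mx j' 0 *m spoke (s j' (lift ord_max k'))))).
  rewrite (bigD1 j) //= [X in _ + X]big1 ?addr0; last first.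
    by move=> j' /negPf h; rewrite big1 // => k' _; rewrite h oppr0 scale0r.
  rewrite eqxx -scaler_sumr -raddf_sum -mulmx_sumr scaleN1r -linearN -mulmxN /=.
  congr (mxvec (_ *m _)); rewrite /label ffunE eqxx permM tpermR.
  have := spoke_sum; rewrite (reindex_inj (@perm_inj _ (s j))) (bigD1_ord ord_max) //=.
  by move/eqP; rewrite addr_eq0 => /eqP.
by rewrite det_set_row_comb mxE eqxx mulN1r.
Qed.

(** Every permutation is a product of transpositions with [ord_max], and each of these is trivial or
    a flip. Starting from the identity facet, the colors are treated one at a time. *)
Lemma det_facet_base s : \det (facet_mx s base) = (orient s)%:~R.
Proof.
have step j p s' : \det (facet_mx s' base) = (orient s')%:~R ->
    \det (facet_mx (mul_at s' j p) base) = (orient (mul_at s' j p))%:~R.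
  have /gen_prodgP[l [c cP ->]] : p \in <<[set tperm ord_max y | y in 'I_n.+1]>>%g.
    by rewrite gen_tperm inE.
  elim/big_ind: _ s' => [s'|q q' IHq IHq' s'|i _ s'].
  - suff -> : mul_at s' j 1%g = s' by [].
    by apply/ffunP => j'; rewrite ffunE mul1g if_same.
  - suff -> : mul_at s' j (q * q')%g = mul_at (mul_at s' j q') j q.
      by move=> h; apply/IHq/IHq'.
    by apply/ffunP => j'; rewrite !ffunE; case: eqP; rewrite ?mulgA.
  - have /imsetP[y _ ->] := cP i.
    case: (unliftP ord_max y) => [k ->|->]; last first.
      rewrite tperm1; suff -> : mul_at s' j 1%g = s' by [].
      by apply/ffunP => j'; rewrite ffunE mul1g if_same.
    have -> : mul_at s' j (tperm ord_max (lift ord_max k)) = flip (mxvec_index j k) s'.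
      by rewrite /flip vertexK.
    by rewrite det_facet_base_flip orient_flip => ->; rewrite rmorphN.
suff H (l : seq 'I_m) s' : (forall j, j \notin l -> s' j = 1%g) ->
    \det (facet_mx s' base) = (orient s')%:~R.
  by apply: (H (enum 'I_m)) => j; rewrite mem_enum.
elim: l s' => [|j l IH] s' hs.
  have -> : s' = [ffun=> 1%g] by apply/ffunP => j; rewrite hs // ffunE.
  by rewrite facet_base1 orient1 det1.
pose s1 : facet := [ffun j' => if j' == j then 1%g else s' j'].
have -> : s' = mul_at s1 j (s' j).
  by apply/ffunP => j'; rewrite !ffunE; case: eqP => [->|//]; rewrite mulg1.
apply: step; apply: IH => j' j'l; rewrite ffunE; case: eqP => // /eqP jj'.
by apply: hs; rewrite inE negb_or jj'.
Qed.

(** Rotating the identity facet of [base] yields the matrix of the action itself. Thus a rotation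
    has the same sign on the space as on the facets. *)
Lemma det_perm_act_shift a :
  \det (perm_act (shift a)) = (orient (rotate a [ffun=> 1%g]))%:~R.
Proof.
have := det_facet_base (rotate a [ffun=> 1%g]).
by rewrite facet_mx_rotate facet_base1 mul1mx.
Qed.

End Degree.

(** * Invariance of the degree modulo [n.+1] *)

Section DegreeMod.
Variables (R : realFieldType) (m n : nat).
Let N := (m * n)%N.
Implicit Types (s : facet m n) (X : 'M[R]_N).

Lemma rotateK (a : 'I_n.+1) : cancel (@rotate m n a) (rotate (- a)).
Proof.
move=> s; apply/ffunP => j; rewrite !ffunE -mulgA shiftD subrr.
suff -> : shift (0 : 'I_n.+1) = 1%g by rewrite mulg1.
by apply/permP => x; rewrite permE perm1 addr0.
Qed.

(** Along an orbit the empty class of color [j0] takes each value exactly once, so the sum is [n.+1]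
    times its part where that class is 0. *)
Lemma dvdz_rotate_sum (j0 : 'I_m) (F : facet m n -> int) :
  (forall a s, F (rotate a s) = F s) -> (n.+1%:Z %| \sum_s F s)%Z.
Proof.
move=> Frot; rewrite (partition_big (fun s : facet m n => s j0 ord_max) predT) //=.
rewrite (eq_bigr (fun=> \sum_(s : facet m n | s j0 ord_max == 0) F s)) => [|a _].
  by rewrite sumr_const card_ord -mulr_natr natz dvdz_mull.
rewrite (reindex_inj (can_inj (rotateK a))) /=.
apply: eq_big => [s|s _]; last exact: Frot.
by rewrite ffunE permM permE -subr_eq0 addrK.
Qed.

Definition nondegenerate w X := forall s,
  off_faces w (facet_mx s X) /\ positively_independent (facet_mx s X).

(** Apply the boundary formula to every facet. The terms replacing a row other than [i0] cancel
    across ridges, those replacing row [i0] form the new degree, and the antipodal terms sum to a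
    multiple of [n.+1]. *)
Lemma degree_set_row_mod (j0 : 'I_m) w X i0 y :
    nondegenerate w X ->
    (forall s, off_faces (y *m perm_act R m (shift (label s i0))) (facet_mx s X)) ->
    (forall s i, off_faces w
      (set_row (facet_mx s X) i (y *m perm_act R m (shift (label s i0))))) ->
  (n.+1%:Z %| degree w X - degree w (set_row X i0 y))%Z.
Proof.
move=> Xgood offy offw; pose Y s := y *m perm_act R m (shift (label s i0)).
suff -> : degree w X = degree w (set_row X i0 y) +
    \sum_s orient s * antipodal_index (Y s) (facet_mx s X).
  rewrite addrAC subrr add0r; apply: (dvdz_rotate_sum j0) => a s.
  (* A rotation multiplies the antipodal index and the orientation by the same sign. *)
  rewrite facet_mx_rotate /Y label_rotate -shiftD -perm_actM mulmxA.
  rewrite antipodal_index_mulmx ?perm_act_unit // orient_rotate.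
  by rewrite det_perm_act_shift sgz_orient mulrACA orient_sqr mulr1.
rewrite /degree (eq_bigr (fun s : facet m n =>
    \sum_i orient s * cone_index w (set_row (facet_mx s X) i (Y s)) +
    orient s * antipodal_index (Y s) (facet_mx s X))); last first.
  move=> s _; have [g1 g2] := Xgood s.
  by rewrite -mulr_sumr -mulrDr -(cone_index_boundary g1 (offw s) (offy s) g2).
rewrite big_split /= exchange_big (bigD1 i0) //= [X in _ + X + _]big1 ?addr0.
  by congr (_ + _); apply: eq_bigr => s _; rewrite facet_mx_set_row.
by move=> i ii0; exact: ridge_cancel.
Qed.

(** Only finitely many proper subspaces, pulled back through the invertible actions, must be
    avoided. A list of configurations is allowed so that one [y] can serve two of them. *)
Lemma common_generic_row (w : 'rV[R]_N) i0 (Xs : seq 'M[R]_N) :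
  exists y : 'rV[R]_N, {in Xs, forall X s,
    let y' := y *m perm_act R m (shift (label s i0)) in
    off_faces y' (facet_mx s X) /\
    forall i k, k != i ->
      ~~ (y' <= set_row (set_row (facet_mx s X) i 0) k w)%MS}.
Proof.
pose P s := perm_act R m (shift (label s i0)).
pose B1 X (q : facet m n * 'I_N) := set_row (facet_mx q.1 X) q.2 0 *m invmx (P q.1).
pose B2 X (q : facet m n * ('I_N * 'I_N)) := 
  (* The filler 0 at equal indices keeps every listed matrix singular; otherwise the zero row
     [q.2.1] does. *)
  (if q.2.2 != q.2.1 then set_row (set_row (facet_mx q.1 X) q.2.1 0) q.2.2 w else 0)
   *m invmx (P q.1).
pose Bs := flatten [seq [seq B1 X q | q : _] ++ [seq B2 X q | q : _] | X <- Xs].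
have Psub s (u : 'rV[R]_N) (B : 'M[R]_N) :
    (u *m P s <= B)%MS -> (u <= B *m invmx (P s))%MS.
  by move=> h; rewrite -[u](mulmxK (perm_act_unit _ _ (shift (label s i0)))) submxMr.
have [|//|y _ yB] := @perturb_off_subspaces R N Bs [::] 0.
  move=> B /flatten_mapP[X _]; rewrite mem_cat => /orP[] /mapP[q _ ->];
    rewrite unitmx_mul negb_and.
    by rewrite set_row0_singular.
  case: q => s [i k] /=; have [_|ki] := eqVneq k i; last first.
    by rewrite (set_rowC _ _ _ ki) set_row0_singular.
  have <- : set_row 0 i 0 = 0 :> 'M[R]_N.
    by apply/matrixP => a b; rewrite !mxE if_same.
  by rewrite set_row0_singular.
exists y => X XXs s /=; split=> [i|i k ki].
  have inB : B1 X (s, i) \in Bs.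
    by apply/flatten_mapP; exists X => //; rewrite mem_cat map_f ?mem_enum.
  apply/negP => /Psub h; exact: (negP (yB _ inB) h).
have inB : B2 X (s, (i, k)) \in Bs.
  by apply/flatten_mapP; exists X => //; rewrite mem_cat map_f ?mem_enum ?orbT.
apply/negP => /Psub h; apply: (negP (yB _ inB)).
by rewrite /B2 /= ki.
Qed.

(** The rows are equalized one by one: the same generic [y] replaces row [i0] in both
    configurations, so the list [l] of rows that may still differ shrinks. *)
Lemma nondegenerate_degree_mod (j0 : 'I_m) w X X' :
    nondegenerate w X -> nondegenerate w X' ->
  (n.+1%:Z %| degree w X - degree w X')%Z.
Proof.
move=> gX gX'.
suff H (l : seq 'I_N) Y Y' : nondegenerate w Y -> nondegenerate w Y' ->
    (forall i, i \notin l -> row i Y = row i Y') ->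
    (n.+1%:Z %| degree w Y - degree w Y')%Z.
  by apply: (H (enum 'I_N)) => // i; rewrite mem_enum.
elim: l Y Y' => [|i0 l IH] Y Y' gY gY' eY.
  have -> : Y = Y' by apply/row_matrixP => i; apply: eY.
  by rewrite subrr dvdz0.
have [y hy] := common_generic_row w i0 [:: Y; Y'].
have step Z : nondegenerate w Z -> Z \in [:: Y; Y'] ->
    nondegenerate w (set_row Z i0 y) /\
    (n.+1%:Z %| degree w Z - degree w (set_row Z i0 y))%Z.
  move=> gZ ZY; have hZ := hy Z ZY; split=> [s|].
    have [o1 o2] := hZ s; have [g1 g2] := gZ s; rewrite facet_mx_set_row; split.
      by apply: off_faces_set_row => // k; apply: o2.
    exact: positively_independent_set_row.
  apply: degree_set_row_mod => // s; first by case: (hZ s).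
  move=> i; have [o1 o2] := hZ s; have [g1 g2] := gZ s.
  by apply: off_faces_set_row => // k; apply: o2.
have [||g1 d1] := step Y; rewrite ?mem_head //.
have [||g2 d2] := step Y'; rewrite ?inE ?eqxx ?orbT //.
have d3 : (n.+1%:Z %| degree w (set_row Y i0 y) - degree w (set_row Y' i0 y))%Z.
  apply: IH => // i il; rewrite !row_set_row; have [//|ii0] := eqVneq i i0.
  by apply: eY; rewrite inE negb_or ii0.
have -> : degree w Y - degree w Y' = (degree w Y - degree w (set_row Y i0 y)) +
    (degree w (set_row Y i0 y) - degree w (set_row Y' i0 y)) -
    (degree w Y' - degree w (set_row Y' i0 y)) by ring.
by rewrite rpredB // rpredD.
Qed.

End DegreeMod.

(** * The degree of the base configuration *)

Section BaseDegree.
Variables (R : realFieldType) (m n : nat).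
Let N := (m * n)%N.
Implicit Types (s : facet m n) (w : 'rV[R]_N).

Lemma facet_base_unit s : facet_mx s (base R m n) \in unitmx.
Proof.
rewrite unitmxE det_facet_base unitfE intr_eq0; apply/negP => /eqP h.
by have := orient_sqr s; rewrite h mulr0 => /eqP; rewrite eq_sym oner_eq0.
Qed.

Lemma card_perm_at (a : 'I_n.+1) : #|[pred p : 'S_n.+1 | p ord_max == a]| = n`!.
Proof.
pose C b := #|[pred p : 'S_n.+1 | p ord_max == b]|.
have Ceq b : C b = C a.
  rewrite /C -!sum1_card (reindex_inj (@mulIg _ (tperm b a))) /=.
  apply: eq_bigl => p; rewrite !inE permM.
  by rewrite -(inj_eq (@perm_inj _ (tperm b a))) tpermK tpermL.
have : (n.+1 * C a = n.+1 * n`!)%N.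
  rewrite -factS -card_Sn -[in LHS](card_ord n.+1) -sum_nat_const.
  under eq_bigr => b _ do rewrite -(Ceq b) /C -sum1_card.
  by rewrite -sum1_card (partition_big (fun p : 'S_n.+1 => p ord_max) predT).
by move/eqP; rewrite eqn_mul2l /= => /eqP.
Qed.

(** Coefficients of row [j] of [w] on all the spokes are unique only up to a common constant; this
    normalization gives the last spoke coefficient 0. *)
Definition barycentric w (j : 'I_m) (a : 'I_n.+1) : R :=
  if unlift ord_max a is Some k then vec_mx w j k else 0.

Lemma barycentric_sum w j :
  \sum_a barycentric w j a *: spoke R a = row j (vec_mx w).
Proof.
rewrite (bigD1_ord ord_max) //= {1}/barycentric unlift_none scale0r add0r.
rewrite [RHS]row_sum_delta; apply: eq_bigr => k _.
by rewrite /barycentric liftK spoke_lift [row _ _ _ _]mxE.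
Qed.

(* Subtracting a multiple of [spoke_sum] makes the coefficient of the unused
   spoke vanish. *)
Lemma base_coord w s i : (w *m invmx (facet_mx s (base R m n))) 0 i =
  barycentric w (vertex i).1 (label s i) -
  barycentric w (vertex i).1 (s (vertex i).1 ord_max).
Proof.
pose u : 'rV[R]_N := \row_i (barycentric w (vertex i).1 (label s i) -
  barycentric w (vertex i).1 (s (vertex i).1 ord_max)).
suff /(mulmx_coord (facet_base_unit s)) -> : u *m facet_mx s (base R m n) = w.
  by rewrite mxE.
rewrite mulmx_sum_row.
under eq_bigr => k _ do rewrite row_facet_base mxE /label.
rewrite (sum_vertex (fun j k => (barycentric w j (s j (lift ord_max k)) -
  barycentric w j (s j ord_max)) *:
  mxvec (delta_mx j 0 *m spoke R (s j (lift ord_max k))))).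
have rows (W : 'M[R]_(m, n)) : W = \sum_j delta_mx j 0 *m row j W.
  apply/matrixP => j k; rewrite summxE (bigD1 j) //= big1 ?addr0.
    by rewrite mxE big_ord1 !mxE !eqxx mul1r.
  by move=> j' h; rewrite mxE big_ord1 !mxE eq_sym (negPf h) mul0r.
rewrite -[RHS]vec_mxK [vec_mx w]rows linear_sum; apply: eq_bigr => j _.
under eq_bigr => k _ do rewrite -linearZ scalemxAr.
rewrite -linear_sum -mulmx_sumr; congr (mxvec (_ *m _)).
rewrite -barycentric_sum (reindex_inj (@perm_inj _ (s j))) /=.
have := congr1 (fun v => barycentric w j (s j ord_max) *: v) (spoke_sum R n).
rewrite (reindex_inj (@perm_inj _ (s j))) scaler0 scaler_sumr /= => e.
rewrite -[RHS]subr0 -[X in _ - X]e -sumrB (bigD1_ord ord_max) //= subrr add0r.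
by apply: eq_bigr => k _; rewrite scalerBl.
Qed.

(** By [base_coord], a facet cone contains [w] exactly when the empty class of each color minimizes
    its barycentric coefficient. This fixes one class per color and leaves [n!] placements; each
    such facet counts +1, as its determinant has the sign of its orientation. *)
Lemma degree_base w : (forall s, off_faces w (facet_mx s (base R m n))) ->
  degree w (base R m n) = (n`! ^ m)%N%:Z.
Proof.
move=> off; pose least j := [arg min_(a < ord_max) barycentric w j a]%O.
have leastP j a : barycentric w j (least j) <= barycentric w j a.
  by rewrite /least; case: arg_minP => // b _; apply.
pose ok s := [forall j, s j ord_max == least j].
have inside s : [forall i, 0 < (w *m invmx (facet_mx s (base R m n))) 0 i] = ok s.
  apply/forallP/forallP => [H j|H i].
    apply/eqP; rewrite -[least j](permKV (s j)).
    case: (unliftP ord_max ((s j)^-1%g (least j))) => [k e|-> //].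
    have := H (mxvec_index j k); rewrite base_coord /label vertexK /= -e permKV.
    by rewrite subr_gt0 ltNge leastP.
  rewrite lt_neqAle eq_sym off_faces_coord ?facet_base_unit //= base_coord.
  by rewrite subr_ge0 (eqP (H _)) leastP.
have -> : degree w (base R m n) = \sum_s (ok s)%:Z.
  apply: eq_bigr => s _; rewrite /cone_index facet_base_unit inside det_facet_base.
  by case: (ok s); rewrite ?mulr0 //= sgz_orient orient_sqr.
have -> : \sum_s (ok s)%:Z =
    #|family (fun j => [pred p : 'S_n.+1 | p ord_max == least j])|%:Z.
  rewrite -sum1_card (big_morph Posz PoszD (erefl _)) [RHS]big_mkcond /=.
  apply: eq_bigr => s _; rewrite [s \in _](_ : _ = ok s); first by case: (ok s).
  by apply/familyP/forallP => H j; exact: H.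
have foldE (T : finType) (F : T -> nat) : (forall x, F x = n`!) ->
    foldr muln 1%N [seq F x | x : T] = (n`! ^ #|T|)%N.
  move=> FE; rewrite cardT /image_mem; elim: (enum T) => //= x l ->.
  by rewrite FE expnS.
congr Posz; rewrite card_family foldE ?card_ord // => j; exact: card_perm_at.
Qed.

End BaseDegree.

(** * Nonvanishing modulo a prime and the resulting nonnegative relation *)

(** By Wilson's theorem [n.+1] divides [n! + 1], so it cannot divide [n!]. *)
Lemma prime_ndvd_fact_exp (n m : nat) : prime n.+1 -> ~~ (n.+1 %| n`! ^ m)%N.
Proof.
move=> pr; apply/negP; rewrite Euclid_dvdX // => /andP[dv _].
have n0 : (0 < n)%N by case: n pr {dv}.
have : (n.+1 %| (n`!).+1)%N by have <- := @Wilson n.+1 n0.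
by rewrite -[(n`!).+1]addn1 dvdn_addr // dvdn1 eqSS => /eqP nz; rewrite nz in n0.
Qed.

Section CommonPoint.
Variables (R : realFieldType) (m n : nat).
Hypothesis n_prime : prime n.+1.
Variables (j0 : 'I_m) (X : 'M[R]_(m * n)) (z : 'rV[R]_(m * n)).

Lemma origin_in_joined_facet : exists s : facet m n, exists l : 'rV[R]_(m * n),
  exists zeta : R, [/\ forall i, 0 <= l 0 i, 0 <= zeta,
    (l != 0) || (zeta != 0) & l *m facet_mx s X + zeta *: z = 0].
Proof.
apply: contrapT => no.
have pos s : positively_independent (facet_mx s X).
  move=> c c0 cX; apply/eqP/negP => /negP cn0; apply: no.
  by exists s, c, 0; rewrite cn0 scale0r addr0.
(* These are the facet coordinates that are negative at [- z]; [w] has to keep them negative. *)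
pose gs := [seq col q.2 (invmx (facet_mx q.1 X)) |
  q <- enum {: facet m n * 'I_(m * n)} &
  (- z *m invmx (facet_mx q.1 X)) 0 q.2 < 0].
pose Bs := [seq set_row (facet_mx q.1 X) q.2 0 | q : facet m n * 'I_(m * n)] ++
  [seq set_row (facet_mx q.1 (base R m n)) q.2 0 | q : facet m n * 'I_(m * n)].
have colE' (u : 'rV[R]_(m * n)) (A : 'M[R]_(m * n)) i :
    (u *m col i A) 0 0 = (u *m A) 0 i.
  by rewrite !mxE; apply: eq_bigr => k _; rewrite mxE.
have [||w wgs wBs] := @perturb_off_subspaces R _ Bs gs (- z).
- by move=> B; rewrite mem_cat => /orP[] /mapP[q _ ->]; exact: set_row0_singular.
- by move=> g /mapP[q]; rewrite mem_filter => /andP[h _] ->; rewrite colE'.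
have offX s : off_faces w (facet_mx s X).
  move=> i; apply: wBs; rewrite mem_cat; apply/orP; left.
  by apply/mapP; exists (s, i); rewrite ?mem_enum.
have offb s : off_faces w (facet_mx s (base R m n)).
  move=> i; apply: wBs; rewrite mem_cat; apply/orP; right.
  by apply/mapP; exists (s, i); rewrite ?mem_enum.
have posb s : positively_independent (facet_mx s (base R m n)).
  move=> c _ cX; have := mulmx_coord (facet_base_unit R s) cX.
  by rewrite mul0mx.
have degX : degree w X = 0.
  apply: big1 => s _; rewrite /cone_index.
  have [uX|_] /= := boolP (facet_mx s X \in unitmx); last by rewrite mulr0.
  case: ifP => [/forallP wpos|_]; last by rewrite mulr0.
  (* If [w] is in this open cone, no coordinate of [- z] was negative, so [- z] is in the closed
     cone. *)
  case: no; exists s, (- z *m invmx (facet_mx s X)), 1.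
  rewrite ler01 oner_eq0 orbT mulmxKV // scale1r addNr; split=> // i.
  rewrite leNgt; apply/negP => neg; have := wpos i; rewrite ltNge => /negP; apply.
  apply: ltW; rewrite -colE'; apply: wgs; apply/mapP; exists (s, i) => //.
  by rewrite mem_filter neg mem_enum.
have := @nondegenerate_degree_mod R m n j0 w (base R m n) X.
rewrite degX subr0 degree_base // dvdzE !absz_nat => H.
have := prime_ndvd_fact_exp m n_prime; rewrite H // => s; split=> //.
Qed.

End CommonPoint.

(** The last point is fixed in class 0. The relation in the tensor space says that the sum of [G a]
    tensored with [spoke a] is 0; the spokes satisfy only multiples of [spoke_sum], so all [G a]
    coincide. *)
Theorem rainbow_weights (R : realFieldType) (m n : nat) (j0 : 'I_m)
    (c : 'I_m -> 'I_n -> 'rV[R]_m) (z : 'rV[R]_m) : prime n.+1 ->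
  exists s : 'I_m -> 'S_n.+1, exists l : 'I_m -> 'I_n -> R, exists zeta : R,
  [/\ forall j k, 0 <= l j k, 0 <= zeta,
      (exists j, exists k, l j k != 0) \/ zeta != 0 &
      forall a b : 'I_n.+1,
      let G a := \sum_j \sum_(k | s j (lift ord_max k) == a) l j k *: c j k +
        (zeta *+ (a == 0)) *: z in G a = G b].
Proof.
move=> pr; pose X : 'M[R]_(m * n) :=
  \matrix_i mxvec ((c (vertex i).1 (vertex i).2)^T *m spoke R 0).
have [s [l [zeta [l0 zeta0 lz]]]] :=
  origin_in_joined_facet pr j0 X (mxvec (z^T *m spoke R 0)).
pose L j k := l 0 (mxvec_index j k).
have vL i : l 0 i = L (vertex i).1 (vertex i).2.
  by case/mxvec_indexP: i => j k; rewrite vertexK.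
move=> e; exists s, L, zeta; split => //.
- by move=> j k; exact: l0.
- case/orP: lz => [/matrix0Pn[i0 [i]]|]; last by right.
  by rewrite ord1 vL => h; left; exists (vertex i).1, (vertex i).2.
pose G a := \sum_j \sum_(k | s j (lift ord_max k) == a) L j k *: c j k +
        (zeta *+ (a == 0)) *: z.
suff G0 : \sum_a (G a)^T *m spoke R a = 0.
  (* Column [k] involves only the [k]-th basis spoke and the last one, with coefficients 1 and
     -1. *)
  have Gmax k : G (lift ord_max k) = G ord_max.
    apply/rowP => j; have := congr1 (fun M : 'M_(m, n) => M j k) G0.
    have entry (u : 'rV[R]_m) (v : 'rV[R]_n) : (u^T *m v) j k = u 0 j * v 0 k.
      by rewrite !mxE big_ord1 mxE.
    rewrite (bigD1_ord ord_max) //= mxE summxE (bigD1 k) //= big1 ?addr0.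
      rewrite !entry spoke_max spoke_lift [const_mx _ _ _]mxE [delta_mx _ _ _ _]mxE.
      rewrite !eqxx mulrN1 mulr1 [X in _ = X]mxE addrC => /eqP.
      by rewrite subr_eq0 => /eqP.
    move=> k' k'k; rewrite entry spoke_lift [delta_mx _ _ _ _]mxE.
    by rewrite [k == k']eq_sym (negPf k'k) andbF mulr0.
  have Gall a : G a = G ord_max.
    by case: (unliftP ord_max a) => [k ->|->].
  by move=> a b /=; rewrite -/(G a) -/(G b) !Gall.
have GE a : (G a)^T *m spoke R a =
    \sum_j \sum_(k | s j (lift ord_max k) == a) L j k *:
       ((c j k)^T *m spoke R (s j (lift ord_max k))) +
    (if a == 0 then zeta *: (z^T *m spoke R 0) else 0).
  rewrite linearD mulmxDl; congr (_ + _).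
    rewrite linear_sum mulmx_suml; apply: eq_bigr => j _.
    rewrite linear_sum mulmx_suml; apply: eq_bigr => k /eqP <-.
    by rewrite linearZ /= -scalemxAl.
  rewrite linearZ /= -scalemxAl; case: eqP => [->|_]; first by rewrite mulr1n.
  by rewrite mulr0n scale0r.
rewrite (eq_bigr _ (fun a _ => GE a)) big_split /= -big_mkcond big_pred1_eq.
rewrite exchange_big /=.
have -> : \sum_j \sum_a \sum_(k | s j (lift ord_max k) == a)
      L j k *: ((c j k)^T *m spoke R (s j (lift ord_max k))) =
    \sum_j \sum_k L j k *: ((c j k)^T *m spoke R (s j (lift ord_max k))).
  apply: eq_bigr => j _.
  by rewrite [RHS](partition_big (fun k => s j (lift ord_max k)) predT).
rewrite -(sum_vertex (fun j k => L j k *: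
  ((c j k)^T *m spoke R (s j (lift ord_max k))))).
apply: (can_inj mxvecK); rewrite linearD linearZ linear_sum linear0 /= -[RHS]e.
congr (_ + _); rewrite [RHS]mulmx_sum_row; apply: eq_bigr => i _.
by rewrite linearZ /= -vL !rowK mul_perm_act -mulmxA mul_spoke_perm permE add0r.
Qed.

(** * Bridge from standard lists and integer primes to MathComp *)

Section Lists.
Variables (T : eqType) (I : Type).

Lemma InP (x : T) (l : seq T) : List.In x l <-> x \in l.
Proof.
elim: l => //= y l IH; rewrite inE; split.
  by case=> [->|/IH ->]; rewrite ?eqxx ?orbT.
by case/predU1P => [->|/IH]; [left|right].
Qed.

Lemma NoDupP (l : seq T) : List.NoDup l <-> uniq l.
Proof.
elim: l => [|x l IH] /=; first by split=> // _; constructor.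
rewrite List.NoDup_cons_iff InP IH; split=> [[/negP -> ->]//|/andP[/negP]].
by [].
Qed.

Lemma List_nthE (A : Type) (x : A) l k : List.nth k l x = nth x l k.
Proof. by elim: l k => [|y l IH] [|k] /=. Qed.

Lemma fold_right_Rplus (f : I -> R) (l : seq I) :
  List.fold_right Rplus 0 (map f l) = \sum_(x <- l) f x.
Proof. by elim: l => [|x l IH]; rewrite ?big_nil // big_cons /= IH. Qed.

Lemma lin_comb_map (f : I -> R) (g : I -> seq R) (l : seq I) k :
  lin_comb (map f l) (map g l) k = \sum_(x <- l) f x * nth 0 (g x) k.
Proof.
rewrite /lin_comb; elim: l => [|x l IH]; rewrite ?big_nil // big_cons /= IH.
by rewrite List_nthE.
Qed.

Lemma Forall_map (P : R -> Prop) (f : I -> R) (l : seq I) :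
  (forall x, P (f x)) -> List.Forall P (map f l).
Proof. by move=> H; elim: l => /=; constructor. Qed.

End Lists.

Lemma primeZ_prime (p : nat) : Znumtheory.prime (BinInt.Z.of_nat p) -> prime p.
Proof.
move=> pr; apply/primeP; split; first by case: pr; lia.
move=> q /dvdnP[k pE].
have : BinInt.Z.divide (BinInt.Z.of_nat q) (BinInt.Z.of_nat p).
  by exists (BinInt.Z.of_nat k); lia.
case/(Znumtheory.prime_divisors _ pr) => [|[|[|]]] e; apply/orP; lia.
Qed.

(** * From equal weighted sums to a rainbow partition *)

Section Transfer.
Variables (d n : nat) (C : nat -> seq (seq R)).
Hypothesis n_prime : prime n.+1.
Hypothesis C_BMZ : BMZ_collection d n.+1 C.

Let index := option ('I_d.+1 * 'I_n)%type.

Definition color (o : index) : nat := if o is Some jk then jk.1 : nat else d.+1.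

Definition point (o : index) : seq R :=
  if o is Some jk then nth [::] (C jk.1) jk.2 else nth [::] (C d.+1) 0.

(** The final coordinate 1 makes equality of weighted sums include equality of total weights. *)
Definition homogenize (x : seq R) : 'rV[R]_d.+1 :=
  \row_i (if (i < d)%N then nth 0 x i else 1).

Lemma color_lt o : (color o < d.+2)%N.
Proof. by case: o => [[j k]|] //=; rewrite ltnW // ltnS. Qed.

Lemma color_bound j : (j < d.+2)%N -> (j < d + 2)%coq_nat.
Proof. by rewrite -addn2 => /ssrnat.ltP. Qed.

Lemma C_uniq j : (j < d.+2)%N -> uniq (C j).
Proof.
by move=> /color_bound jd; apply/NoDupP; have [H _] := C_BMZ; have [] := H j jd.
Qed.

Lemma C_disjoint j k x :
  (j < d.+2)%N -> (k < d.+2)%N -> x \in C j -> x \in C k -> j = k.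
Proof.
move=> /color_bound jd /color_bound kd /InP xj /InP xk.
by have [//|/eqP jk] := eqVneq j k; have [_ [_ [_ /(_ j k x jd kd jk xj)]]] := C_BMZ.
Qed.

Lemma C_size j : (j < d.+1)%N -> size (C j) = n.
Proof.
move=> jd; have [_ [H _]] := C_BMZ.
rewrite -[size _]/(List.length _) H; first by lia.
by apply/ssrnat.ltP; rewrite -[(d + 1)%coq_nat]/(d + 1)%N addn1.
Qed.

Lemma C_last_size : size (C d.+1) = 1%N.
Proof.
have [_ [_ [H _]]] := C_BMZ.
by rewrite -H -[(d + 1)%coq_nat]/(d + 1)%N addn1.
Qed.

Lemma point_in o : point o \in C (color o).
Proof.
case: o => [[j k]|] /=; first by rewrite mem_nth // C_size.
by rewrite mem_nth // C_last_size.
Qed.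

Lemma color_of o j : (j < d.+2)%N -> point o \in C j -> color o = j.
Proof. by move=> jd oj; apply: C_disjoint (color_lt o) jd (point_in o) oj. Qed.

Lemma point_inj : injective point.
Proof.
move=> o o' e.
have : color o = color o' by apply: color_of (color_lt o') _; rewrite e point_in.
case: o o' e => [[j k]|] [[j' k']|] //= e ej.
- have jj' : j = j' by apply: val_inj.
  rewrite -jj' in e *; move/eqP: e; rewrite nth_uniq ?C_size //.
    by move/eqP/val_inj ->.
  by rewrite C_uniq // ltnW // ltnS.
- by have := ltn_ord j; rewrite ej ltnn.
- by have := ltn_ord j'; rewrite -ej ltnn.
Qed.

Lemma rainbow_partition : tverberg_rainbow_partition d n.+1 C.
Proof.
have [s [l [zeta [l0 zeta0 nz Geq]]]] := rainbow_weights (ord0 : 'I_d.+1)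
  (fun j k => homogenize (point (Some (j, k)))) (homogenize (point None)) n_prime.
pose wt (o : index) := if o is Some jk then l jk.1 jk.2 else zeta.
pose cls (o : index) : 'I_n.+1 := if o is Some jk then s jk.1 (lift ord_max jk.2) else 0.
have wt0 o : 0 <= wt o by case: o => [[j k]|] /=.
pose G a : 'rV[R]_d.+1 := \sum_(o | cls o == a) wt o *: homogenize (point o).
have GE a : G a = G 0.
  have sumE b : G b = \sum_j \sum_(k | s j (lift ord_max k) == b) l j k *:
      homogenize (point (Some (j, k))) + (zeta *+ (b == 0)) *: homogenize (point None).
    rewrite /G big_mkcond (bigD1 None) //= addrC; congr (_ + _).
      rewrite (reindex_omap Some id) /=; last by case.
      under [RHS]eq_bigr => j _ do rewrite big_mkcond.
      rewrite [RHS]pair_big /=; apply: eq_big => [[j k]|[j k] _] //=.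
      by rewrite eqxx.
    by rewrite eq_sym; case: eqP => _; rewrite ?mulr1n ?mulr0n ?scale0r.
  by rewrite !sumE; exact: Geq.
(* The homogenizing coordinate is the total weight of each class. It is positive, so dividing by it
   yields convex combinations. *)
pose W := G 0 0 ord_max.
have WE a : \sum_(o | cls o == a) wt o = W.
  rewrite /W -(GE a) summxE; apply: eq_bigr => o _.
  by rewrite !mxE ltnn mulr1.
have Wpos : 0 < W.
  have [o on0] : exists o, wt o != 0.
    by case: nz => [[j [k h]]|h]; [exists (Some (j, k))|exists None].
  rewrite -(WE (cls o)) (bigD1 o) //= ltr_wpDr ?sumr_ge0 //.
  by rewrite lt_neqAle eq_sym on0 wt0.
have Wn0 : W != 0 by rewrite gt_eqF.
pose cell (i : nat) : seq index := [seq o <- enum {: index} | cls o == i :> nat].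
have cellP i x : List.In x (map point (cell i)) ->
    exists2 o, cls o = i :> nat & x = point o.
  move/InP/mapP => [o]; rewrite mem_filter => /andP[/eqP h _] ->.
  by exists o.
exists (fun i => map point (cell i)); split; [|split; [|split; [|split]]].
- move=> i _; apply/NoDupP; rewrite (map_inj_uniq point_inj) filter_uniq //.
  exact: enum_uniq.
- move=> i i' x _ _ ii' /cellP[o oi ->] /cellP[o' oi' /point_inj oo'].
  by apply: ii'; rewrite -oi -oi' oo'.
- move=> i x _ /cellP[o _ ->]; exists (color o); split; last exact/InP/point_in.
  exact/color_bound/color_lt.
- move=> i j x y _ /ssrnat.ltP jd /cellP[o oi ->] /cellP[o' oi' ->] /InP oj /InP oj'.
  rewrite -[(d + 2)%coq_nat]/(d + 2)%N addn2 in jd.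
  have e : color o = color o' by rewrite (color_of jd oj) (color_of jd oj').
  have {oi oi'} : cls o = cls o' by apply: val_inj; rewrite /= oi oi'.
  move=> ec; congr point; move: ec; case: o o' e {oj oj'} => [[j1 k]|] [[j2 k']|] //= e.
  + have <- : j1 = j2 by apply: val_inj.
    (* Two points of one color in one class coincide because a color is placed by a permutation. *)
    by move/perm_inj/lift_inj => ->.
  + by have := ltn_ord j1; rewrite e ltnn.
  + by have := ltn_ord j2; rewrite -e ltnn.
exists (mkseq (fun k => G 0 0 (inord k) / W) d); split.
  by rewrite /is_point -[List.length _]/(size _) size_mkseq.
move=> i /ssrnat.ltP id; exists (map (fun o => wt o / W) (cell i)); split.
  by rewrite -![List.length _]/(size _) !size_map.
have cellE (F : index -> R) : \sum_(o <- cell i) F o = \sum_(o | cls o == Ordinal id) F o.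
  by rewrite big_filter big_enum_cond; apply: eq_bigl => o.
split; first by apply: Forall_map => o; apply/RleP; rewrite divr_ge0 // ltW.
split; first by rewrite fold_right_Rplus cellE -mulr_suml WE divff.
move=> k; rewrite -[List.length _]/(size _) size_mkseq => /ssrnat.ltP kd.
rewrite List_nthE nth_mkseq // lin_comb_map cellE -(GE (Ordinal id)) summxE.
rewrite mulr_suml; apply: eq_bigr => o _.
by rewrite !mxE inordK ?kd 1?ltnW // mulrAC.
Qed.

End Transfer.

End ColoredTverberg.

Theorem theorem2 (d r : nat) (hd : (1 <= d)%nat) (hr : prime (Z.of_nat r))
  (C : nat -> list (list R)) (hC : BMZ_collection d r C) :
  tverberg_rainbow_partition d r C.
Proof.
pose proof (ColoredTverberg.primeZ_prime hr) as pr.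
destruct r as [|n]; [discriminate pr|].
exact (ColoredTverberg.rainbow_partition pr hC).
Qed.
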